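(* Assume there exist $\varepsilon_{\mathbb S}>0$ and $d>0$ such that for every $\varepsilon\in(0,\varepsilon_{\mathbb S})$ and every $(x,s)\in\mathbb X\times\mathbb S$: $$\sum_{n\ge1}\mathbb P_{(x,0)}(|S_n-s|<\varepsilon)=\infty,$$ $$\liminf_{N\to\infty}\frac{\sum_{n,m=1}^N\mathbb P_{(x,0)}(|S_n-s|<\varepsilon,\ |S_{n+m}-s|<\varepsilon)}{\big(\sum_{n=1}^N\mathbb P_{(x,0)}(|S_n-s|<\varepsilon)\big)^2}\le d.$$ Then $\mathcal R_{(\mu,0)}=\mathbb S$ for every probability measure $\mu$ on $(\mathbb X,\mathcal X)$.
   Context: $(\mathbb X,\mathcal X)$ is a measurable space. A Markov random walk (MRW) on $\mathbb X\times\mathbb R^2$ is a Markov chain $(X_n,S_n)_{n\ge0}$ with values in $\mathbb X\times\mathbb R^2$ whose transition kernel $P$ satisfies $P((x,s);A\times S)=P((x,0);A\times(S-s))$ for all $(x,s)\in\mathbb X\times\mathbb R^2$, $A\in\mathcal X$ and Borel $S\subset\mathbb R^2$; then $(X_n)_n$ is itself a Markov chain (the driving chain), with transition kernel denoted $Q$. One always takes $S_0=0$. For a probability measure $\mu$ on $\mathbb X$, $\mathbb P_{(\mu,0)}$ (expectation $\mathbb E_{(\mu,0)}$) is the law of the chain with $X_0\sim\mu$, $S_0=0$; $\mathbb P_{(x,0)}:=\mathbb P_{(\delta_x,0)}$. Standing assumptions: $Q$ has an invariant probability measure $\pi$; $S_1$ is $\mathbb P_{(\pi,0)}$-integrable with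 $\mathbb E_{(\pi,0)}[S_1]=0$; there is a two-dimensional closed subgroup $\mathbb S$ of $\mathbb R^2$ with $\mathbb P_{(x,0)}(S_n\in\mathbb S)=1$ for all $x\in\mathbb X$, $n\ge0$. $|\cdot|$ is the Euclidean norm, $B(s,\varepsilon)$ the open Euclidean ball, $m_{\mathbb S}$ a Haar measure on $\mathbb S$ (viewed as a measure on $\mathbb R^2$). The recurrence set is $\mathcal R_{(\mu,0)}:=\{s\in\mathbb S:\ \forall\varepsilon>0,\ \mathbb P_{(\mu,0)}(|S_n-s|<\varepsilon\text{ for infinitely many }n)=1\}$, $\mathcal R_{(x,0)}:=\mathcal R_{(\delta_x,0)}$. *)

(* Defs.v *)
From HB Require Import structures.
From mathcomp Require Import all_boot all_order all_algebra.
From mathcomp Require Import all_classical all_reals all_analysis.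
Set Implicit Arguments. Unset Strict Implicit. Unset Printing Implicit Defensive.
Import Order.TTheory GRing.Theory Num.Theory.
Import numFieldNormedType.Exports.
Local Open Scope classical_set_scope.
Local Open Scope ring_scope.

Notation state X R := (X * (R * R))%type.

Definition dist2 {R : realType} (u v : R * R) : R :=
  Num.sqrt ((u.1 - v.1) ^+ 2 + (u.2 - v.2) ^+ 2).

Definition shiftS {R : realType} (S : set (R * R)) (s : R * R) : set (R * R) :=
  [set (t.1 - s.1, t.2 - s.2) | t in S].

Fixpoint iter_kernel {d} {X : measurableType d} {R : realType}
  (P : R.-pker (state X R) ~> (state X R)) (Bs : seq (set (state X R)))
  (z : state X R) : \bar R :=
  match Bs with
  | [::] => 1%E
  | B :: Bs' => (\int[P z]_y ((\1_B y)%:E * iter_kernel P Bs' y))%E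
  end.

(* Z is, under Pr, a Markov chain with transition kernel P and initial law
   mu (x) delta_0, characterised by its finite dimensional distributions:
   Pr(Z_0 in B_0, ..., Z_n in B_n)
     = \int mu(dx) 1_{B_0}(x,0) \int P((x,0),dz_1) 1_{B_1}(z_1) ... *)
Definition is_MRW_chain {d dO} {X : measurableType d} {Om : measurableType dO}
  {R : realType} (P : R.-pker (state X R) ~> (state X R))
  (Z : nat -> Om -> state X R) (mu : probability X R) (Pr : probability Om R) :=
  forall (B0 : set (state X R)) (Bs : seq (set (state X R))),
    measurable B0 -> (forall i, (i < size Bs)%N -> measurable (nth setT Bs i)) ->
    Pr ([set w | B0 (Z 0%N w)] `&`
        [set w | forall i, (i < size Bs)%N -> nth setT Bs i (Z i.+1 w)])
    = (\int[mu]_x ((\1_B0 (x, (0%R : R, 0%R : R)))%:E * iter_kernel P Bs (x, (0%R : R, 0%R : R))))%E.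

Definition closed_subgroup2 {R : realType} (S : set (R * R)) :=
  [/\ closed S, S (0, 0),
      (forall u v, S u -> S v -> S (u.1 - v.1, u.2 - v.2)) &
      exists u v, [/\ S u, S v & u.1 * v.2 - u.2 * v.1 != 0]].

Definition recurrence_set {dO} {Om : measurableType dO} {R : realType} {X : Type}
  (Z : nat -> Om -> X * (R * R)) (Pr : probability Om R) (S : set (R * R)) :
  set (R * R) :=
  [set s | S s /\ forall eps : R, 0 < eps ->
     Pr [set w | forall N, exists2 n, (N <= n)%N & dist2 (Z n w).2 s < eps] = 1%E].

(* Main.v *)
Require Import Defs.
From HB Require Import structures.
From mathcomp Require Import all_boot all_order all_algebra.
From mathcomp Require Import all_classical all_reals all_analysis.
From mathcomp Require Import measurable_realfun ring lra.
Import Order.TTheory GRing.Theory Num.Theory.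
Import numFieldNormedType.Exports.
Local Open Scope classical_set_scope.
Local Open Scope ring_scope.

(** The Kochen-Stone second moment argument bounds below, by a constant c > 0
    independent of (x, s), the probability that the walk started at x ever
    visits B(s, eps). By translation invariance, from any state (x, t) with t in
    the subgroup the probability of avoiding B(s, eps) forever is thus at most
    1 - c. If v is the probability of avoiding B(s, eps) at all times > N and
    v_M that of avoiding it at times N+1, ..., N+M, the Markov property at time
    N + M gives v <= (1 - c) v_M; letting M tend to infinity, v <= (1 - c) v,
    so v = 0. This replaces the usual appeal to Levy's 0-1 law. *)

(** * Limits of integrals of decreasing sequences *)

Section integration.
Local Open Scope ereal_scope.
Context d (T : measurableType d) (R : realType).

Lemma measurable_funM_indic (B : set T) (f : T -> \bar R) : measurable B ->
  measurable_fun setT f -> measurable_fun setT (fun x => (\1_B x)%:E * f x).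
Proof.
move=> mB mf; apply: emeasurable_funM => //.
by apply/measurable_EFinP; exact: measurable_indic.
Qed.

Lemma lee_indicMl (B : set T) (x : T) (y : \bar R) : 0 <= y ->
  (\1_B x)%:E * y <= y.
Proof.
by move=> y0; rewrite indicE; case: (x \in B); rewrite ?mul1e ?mul0e.
Qed.

(** Dominated convergence, with the constant 1 as dominating function, moves the limit inside the
    integral; the pointwise bound on [G] then holds almost everywhere since [mu] does not charge the
    complement of [G]. This is one step of the chain in the Markov property argument. *)
Lemma lim_integral_indic_le (mu : {measure set T -> \bar R}) (B G : set T)
    (u : nat -> T -> \bar R) (w : T -> \bar R) (r : R) :
  mu setT = 1 -> measurable B -> measurable G -> mu (~` G) = 0 ->
  (forall n, measurable_fun setT (u n)) ->
  (forall n x, 0 <= u n x <= 1) ->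
  (forall x, {homo u ^~ x : n m / (n <= m)%N >-> m <= n}) ->
  measurable_fun setT w -> (forall x, 0 <= w x) -> (0 <= r)%R ->
  (forall x, G x -> limn (u ^~ x) <= r%:E * w x) ->
  limn (fun n => \int[mu]_x ((\1_B x)%:E * u n x)) <=
  r%:E * \int[mu]_x ((\1_B x)%:E * w x).
Proof.
move=> mu1 mB mG muG mu_ u01 udec mw w0 r0 ulim.
have ucvg x : u ^~ x @ \oo --> limn (u ^~ x).
  exact: ereal_nonincreasing_is_cvgn (udec x).
have mlim : measurable_fun setT (fun x => limn (u ^~ x)).
  by apply: (emeasurable_fun_cvg u) => // x _; exact: ucvg.
have lim0 x : 0 <= limn (u ^~ x).
  apply: lime_ge; first exact: ucvg.
  by apply: nearW => n; case/andP: (u01 n x).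
have i0 x : 0 <= (\1_B x)%:E :> \bar R by rewrite lee_fin.
have [] := @dominated_convergence _ _ R mu setT measurableT
  (fun n x => (\1_B x)%:E * u n x) (fun x => (\1_B x)%:E * limn (u ^~ x))
  (cst 1).
- by move=> n; exact: measurable_funM_indic.
- exact: measurable_funM_indic.
- by apply: nearW => x _; apply: cvgeZl => //; exact: ucvg.
- apply/integrableP; split => //.
  under eq_integral do rewrite /= normr1.
  by rewrite integral_cst// mu1 mule1 ltry.
- apply: nearW => x n _; case/andP: (u01 n x) => u0 u1.
  rewrite gee0_abs; last by rewrite mule_ge0.
  by apply: le_trans u1; exact: lee_indicMl.
move=> _ _ /cvg_lim -> //.
have mw' : measurable_fun setT (fun x => (\1_B x)%:E * w x).
  exact: measurable_funM_indic.
rewrite -ge0_integralZl//; last by move=> x _; rewrite mule_ge0.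
apply: ae_ge0_le_integral => //.
- by move=> x _; rewrite mule_ge0.
- exact: measurable_funM_indic.
- by move=> x _; rewrite !mule_ge0.
- exact: emeasurable_funM.
exists (~` G); split => //; first exact: measurableC.
move=> x /=; apply: contra_not => Gx _.
by rewrite muleCA; apply: lee_pmul => //; exact: ulim.
Qed.

End integration.

(** * Finite-dimensional probabilities as iterated integrals of the kernel *)

Section iterated_kernel.
Local Open Scope ereal_scope.
Context {d} {X : measurableType d} {R : realType}.
Variable P : R.-pker (state X R) ~> (state X R).
Implicit Types (Bs Cs : seq (set (state X R))) (z : state X R).

Lemma iter_kernel_ge0 Bs z : 0 <= iter_kernel P Bs z.
Proof.
elim: Bs z => [|B Bs IH] z //=.
by apply: integral_ge0 => y _; rewrite mule_ge0// lee_fin.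
Qed.

Definition measurable_seq Bs :=
  forall i, (i < size Bs)%N -> measurable (nth setT Bs i).

Lemma measurable_seq_cons B Bs : measurable_seq (B :: Bs) ->
  measurable B /\ measurable_seq Bs.
Proof. by move=> mBs; split => [|i]; [exact: (mBs 0%N)|exact: (mBs i.+1)]. Qed.

Lemma measurable_seq_nseq n B : measurable B -> measurable_seq (nseq n B).
Proof. by move=> mB i; rewrite size_nseq => ni; rewrite nth_nseq ni. Qed.

Lemma measurable_seq_cat Bs Cs : measurable_seq Bs -> measurable_seq Cs ->
  measurable_seq (Bs ++ Cs).
Proof.
move=> mBs mCs i; rewrite size_cat nth_cat; move=> iBC; case: ltnP => [|Bsi].
  exact: mBs.
by apply: (mCs (i - size Bs)%N); rewrite ltn_subLR.
Qed.

Lemma measurable_iter_kernel Bs : measurable_seq Bs ->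
  measurable_fun setT (iter_kernel P Bs).
Proof.
elim: Bs => [|B Bs IH] //= /measurable_seq_cons[mB mBs].
apply: measurable_fun_integral_kernel.
- by move=> U mU; exact: measurable_kernel.
- by move=> y; rewrite mule_ge0// ?lee_fin// iter_kernel_ge0.
- by apply: measurable_funM_indic => //; exact: IH.
Qed.

Lemma iter_kernel_le1 Bs z : measurable_seq Bs -> iter_kernel P Bs z <= 1.
Proof.
elim: Bs z => [|B Bs IH] z //= /measurable_seq_cons[mB mBs].
have P1 : P z setT = 1 by exact: prob_kernel.
rewrite -P1 -[leRHS]mul1e -integral_cst//.
apply: ge0_le_integral => //.
- by move=> y _; rewrite mule_ge0// ?lee_fin// iter_kernel_ge0.
- by apply: measurable_funM_indic => //; exact: measurable_iter_kernel.
- move=> y _; apply: (@le_trans _ _ (iter_kernel P Bs y)); last exact: IH.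
  by apply: lee_indicMl; exact: iter_kernel_ge0.
Qed.

(** Constraints at later times can only lower the probability: the innermost integrand 1 is replaced
    by some [iter_kernel P Cs], which is at most 1. *)
Lemma iter_kernel_cat_le Bs Cs z : measurable_seq Bs -> measurable_seq Cs ->
  iter_kernel P (Bs ++ Cs) z <= iter_kernel P Bs z.
Proof.
move=> + mCs; elim: Bs z => [|B Bs IH] z /=; first by rewrite iter_kernel_le1.
move=> /measurable_seq_cons[mB mBs].
apply: ge0_le_integral => //.
- by move=> y _; rewrite mule_ge0// ?lee_fin// iter_kernel_ge0.
- apply: measurable_funM_indic => //; apply: measurable_iter_kernel.
  exact: measurable_seq_cat.
- by apply: measurable_funM_indic => //; exact: measurable_iter_kernel.
- by move=> y _; rewrite lee_pmul ?lee_fin ?iter_kernel_ge0 ?IH.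
Qed.

Lemma iter_kernel_nseq_nonincreasing Bs D z : measurable_seq Bs -> measurable D ->
  {homo (fun n => iter_kernel P (Bs ++ nseq n D) z) : n m / (n <= m)%N >-> m <= n}.
Proof.
move=> mBs mD n m /subnKC <-; rewrite nseqD catA.
apply: iter_kernel_cat_le; last exact: measurable_seq_nseq.
by apply: measurable_seq_cat => //; exact: measurable_seq_nseq.
Qed.

(** The Markov property at time [size Bs]: after the first block of constraints the chain is still
    in the absorbing set [G], from where it stays in [D] forever with probability at most [r].
    Induction on [Bs] peels off one kernel at a time and applies [lim_integral_indic_le] to it. *)
Lemma lim_iter_kernel_cat_le Bs (D G : set (state X R)) (r : R) :
  measurable_seq Bs -> measurable D -> measurable G -> (0 <= r)%R ->
  (forall z, G z -> P z (~` G) = 0) ->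
  (forall z, G z -> limn (fun n => iter_kernel P (nseq n D) z) <= r%:E) ->
  forall z, G z -> limn (fun n => iter_kernel P (Bs ++ nseq n D) z) <=
                   r%:E * iter_kernel P Bs z.
Proof.
move=> + mD mG r0 PG limD.
elim: Bs => [_ z Gz|B Bs IH /measurable_seq_cons[mB mBs] z Gz] /=.
  by rewrite mule1 limD.
have mBD n : measurable_seq (Bs ++ nseq n D).
  by apply: measurable_seq_cat => //; exact: measurable_seq_nseq.
apply: (@lim_integral_indic_le _ _ _ _ _ G) => //.
- exact: prob_kernel.
- exact: PG.
- by move=> n; exact: measurable_iter_kernel.
- by move=> n x; rewrite iter_kernel_ge0 iter_kernel_le1.
- by move=> x; exact: iter_kernel_nseq_nonincreasing.
- exact: measurable_iter_kernel.
- by move=> x; exact: iter_kernel_ge0.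
- by move=> x; apply: IH.
Qed.

End iterated_kernel.

(** * Measurability in the plane, translations, and complements of balls *)

Section plane.
Context {R : realType}.
Implicit Types (s t u : R * R).

(** The sigma-algebra here is the product one, so [U] is written as the countable union of the boxes
    with rational centres and radii that it contains. *)
Lemma measurable_open_prod (U : set (R * R)) : open U -> measurable U.
Proof.
move=> oU.
pose Q (q : (rat * rat) * (rat * rat)) : set (R * R) :=
  ball (ratr q.1.1 : R) (ratr q.1.2) `*` ball (ratr q.2.1 : R) (ratr q.2.2).
have -> : U = \bigcup_q (if pselect (Q q `<=` U) then Q q else set0).
  apply/seteqP; split => [[x y] Uxy|xy [q _]]; last by case: pselect => //= QU /QU.
  have [[/= V W] [nV nW] VWU] : nbhs (x, y) U by exact: open_nbhs_nbhs.
  have rat_ball (z : R) (A : set R) : nbhs z A -> exists c r,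
      ball (ratr c : R) (ratr r) z /\ ball (ratr c : R) (ratr r) `<=` A.
    move=> nA; have zA : z \in (A^° : set R) by apply/mem_set.
    have [c [r [/set_mem zcr crA]]] := open_subball_rat (@open_interior _ A) zA.
    by exists c, r; split => //; apply: subset_trans crA _; exact: interior_subset.
  have [c1 [r1 [x1 V1]]] := rat_ball _ _ nV.
  have [c2 [r2 [y2 W2]]] := rat_ball _ _ nW.
  exists ((c1, r1), (c2, r2)) => //; case: pselect => //= QU.
  exfalso; apply: QU => -[x' y'] [/= /V1 Vx' /W2 Wy'].
  exact: (VWU (x', y')).
apply: countable_bigcupT_measurable => //.
by move=> q; case: pselect => //= _; apply: measurableX; exact: measurable_ball.
Qed.

Lemma measurable_closed_prod (S : set (R * R)) : closed S -> measurable S.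
Proof.
move=> cS; rewrite -[S]setCK; apply: measurableC.
by apply: measurable_open_prod; exact: closed_openC.
Qed.

Lemma measurable_dist2 s : measurable_fun setT (fun u => dist2 u s).
Proof.
apply: (measurableT_comp (continuous_measurable_fun (@sqrt_continuous R))).
by apply: measurable_funD; apply: measurable_funX; apply: measurable_funB.
Qed.

Definition translate {X : Type} t (z : X * (R * R)) : X * (R * R) :=
  (z.1, (z.2.1 + t.1, z.2.2 + t.2)).

Lemma measurable_translate {d} {X : measurableType d} t :
  measurable_fun [set: state X R] (translate t).
Proof.
apply: measurable_fun_pair => //; apply: measurable_fun_pair.
- by apply: measurable_funD => //; exact: measurableT_comp measurable_fst measurable_snd.
- by apply: measurable_funD => //; exact: measurableT_comp measurable_snd measurable_snd.
Qed.

(** The complement of the ball, taken in the full state space so that it can serve as a constraint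
    in [iter_kernel]. *)
Definition far {X : Type} s (eps : R) : set (X * (R * R)) :=
  [set z | eps <= dist2 z.2 s].

Lemma measurable_far {d} {X : measurableType d} s eps :
  measurable (far s eps : set (state X R)).
Proof.
rewrite -[far _ _]setTI; apply: measurable_fun_le => //.
exact: measurableT_comp (measurable_dist2 s) measurable_snd.
Qed.

Lemma preimage_translate_far {X : Type} s t eps :
  translate t @^-1` far s eps = far (s.1 - t.1, s.2 - t.2) eps :> set (X * (R * R)).
Proof.
apply/seteqP; split => z; rewrite /far /translate /dist2 /=.
all: by rewrite !opprB !addrA ![_ + t.1 - _]addrAC ![_ + t.2 - _]addrAC.
Qed.

End plane.

(** * Translation invariance of the kernel and of its iterates *)

Section translation.
Local Open Scope ereal_scope.
Context {d} {X : measurableType d} {R : realType}.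
Variable P : R.-pker (state X R) ~> (state X R).
Hypothesis Ptrans : forall (x : X) (s : R * R) (A : set X) (S : set (R * R)),
  measurable A -> measurable S ->
  P (x, s) (A `*` S) = P (x, (0%R, 0%R)) (A `*` shiftS S s).

Lemma shiftSE (S : set (R * R)) s :
  shiftS S s = [set u | S (u.1 + s.1, u.2 + s.2)%R].
Proof.
apply/seteqP; split => [_ [[t1 t2] St <-]|u Su] /=; first by rewrite !subrK.
by exists (u.1 + s.1, u.2 + s.2)%R => //=; rewrite !addrK -surjective_pairing.
Qed.

(** [Ptrans] speaks of rectangles only. They form a generating family closed under intersection, so
    two finite measures that agree on them agree everywhere. *)
Lemma kernel_translate t z B : measurable B ->
  P (translate t z) B = P z (translate t @^-1` B).
Proof.
move=> mB; case: z => x s.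
have mt : measurable_fun [set: state X R] (translate t) by exact: measurable_translate.
rewrite -[RHS]/(pushforward (P (x, s)) (translate t) B).
pose m2 : {measure set (state X R) -> \bar R} := pushforward (P (x, s)) (translate t).
apply: (measure_unique _ (fun=> setT)
  (@measurable_prod_measurableType _ _ X (R * R)%type) _ _ _
  (P (translate t (x, s))) (m2 mt)) => //.
- move=> _ _ [A1 mA1 [A2 mA2 <-]] [B1 mB1 [B2 mB2 <-]].
  rewrite -setXI; exists (A1 `&` B1); first exact: measurableI.
  by exists (A2 `&` B2) => //; exact: measurableI.
- by move=> _; exists setT => //; exists setT => //; rewrite setXTT.
- by rewrite bigcup_const.
- move=> _ [A mA [S mS <-]].
  transitivity (P (x, s) (A `*` shiftS S t)); last by rewrite shiftSE.
  (* Both sides are brought back to the kernel at [(x, 0)], where they evaluate [S] shifted by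
     [s + t] at once, or by [t] and then [s]. *)
  rewrite Ptrans// [in RHS]Ptrans//; last first.
    rewrite shiftSE -[X in measurable X]setTI.
    have : measurable_fun [set: R * R] (fun u => (u.1 + t.1, u.2 + t.2)%R).
      by apply: measurable_fun_pair; apply: measurable_funD.
    exact.
  congr (P _ (_ `*` _)); rewrite !shiftSE.
  by apply/seteqP; split => u /=; rewrite !addrA.
- by move=> _; have -> : P (translate t (x, s)) setT = 1; [exact: prob_kernel|exact: ltry].
Qed.

Lemma iter_kernel_translate t Bs z : measurable_seq Bs ->
  iter_kernel P Bs (translate t z) =
  iter_kernel P [seq translate t @^-1` B | B <- Bs] z.
Proof.
have mt : measurable_fun [set: state X R] (translate t) by exact: measurable_translate.
elim: Bs z => [|B Bs IH] z //= /measurable_seq_cons[mB mBs].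
rewrite (@eq_measure_integral _ _ _ _ (pushforward (P z) (translate t))); last first.
  by move=> A mA _; rewrite /= kernel_translate.
rewrite ge0_integral_pushforward//; last 2 first.
- by apply: measurable_funM_indic => //; exact: measurable_iter_kernel.
- by move=> y _; rewrite mule_ge0// ?lee_fin// iter_kernel_ge0.
rewrite preimage_setT; apply: eq_integral => y _ /=.
by rewrite IH.
Qed.

(** Moves the starting point to the origin, where the moment hypotheses are stated; the target
    becomes [s - t]. *)
Lemma avoid_translate n s (eps : R) x t :
  iter_kernel P (nseq n (far s eps)) (x, t) =
  iter_kernel P (nseq n (far (s.1 - t.1, s.2 - t.2)%R eps)) (x, (0%R, 0%R)).
Proof.
have -> : nseq n (far (s.1 - t.1, s.2 - t.2)%R eps) =
    [seq translate t @^-1` B | B <- nseq n (@far R X s eps)].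
  by rewrite map_nseq preimage_translate_far.
rewrite -iter_kernel_translate.
  by rewrite /translate /= !add0r -surjective_pairing.
by apply: measurable_seq_nseq; exact: measurable_far.
Qed.

End translation.

(** * The second moment method for a union of events *)

Section second_moment.

(** The square splits into the diagonal and two triangles, equal by symmetry. In the triangle
    [n < k], put [k = n + m]; letting [m] run up to [N] instead of [N - n] only adds nonnegative
    terms. *)
Lemma sum_symmetric_le (R : realDomainType) (f : nat -> nat -> R) N :
  (forall n k, f n k = f k n) -> (forall n k, 0 <= f n k) ->
  \sum_(1 <= n < N.+1) \sum_(1 <= k < N.+1) f n k <=
  \sum_(1 <= n < N.+1) f n n +
  (\sum_(1 <= n < N.+1) \sum_(1 <= m < N.+1) f n (n + m)%N) *+ 2.
Proof.
move=> fC f0; set s := index_iota 1 N.+1.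
have -> : \sum_(n <- s) \sum_(k <- s) f n k = \sum_(n <- s) f n n +
    (\sum_(n <- s) \sum_(k <- s | (n < k)%N) f n k) *+ 2.
  transitivity (\sum_(n <- s) (f n n + \sum_(k <- s | (n < k)%N) f n k +
      \sum_(k <- s | (k < n)%N) f n k)).
    apply: eq_big_seq => n sn; rewrite (bigD1_seq n) ?iota_uniq//= -addrA.
    congr (_ + _); rewrite (bigID (fun k => (n < k)%N)) /=; congr (_ + _).
      by apply: eq_bigl => k; rewrite andb_idl// => /gtn_eqF ->.
    by apply: eq_bigl => k; rewrite -leqNgt ltn_neqAle.
  rewrite !big_split /= -addrA mulr2n; congr (_ + (_ + _)).
  rewrite (exchange_big_dep predT)//=.
  by apply: eq_bigr => k _; apply: eq_bigr => n _; exact: fC.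
rewrite lerD2l lerMn2r /=; apply: ler_sum => n _.
rewrite -(big_nat_widenl _ _ _ predT)// -[in X in X <= _](add0n n.+1) big_addn.
rewrite /s big_add1 /= subSS [leRHS](@big_cat_nat _ _ _ (N - n)) ?leq_subr//=.
under eq_bigr do rewrite addnS addnC -addnS.
by rewrite lerDl sumr_ge0.
Qed.

Context d (T : measurableType d) (R : realType).
Variable mu : probability T R.

(** A linearised Cauchy-Schwarz inequality. With [a] the number of events [A i] that occur,
    integrate [2 * l * a <= l ^+ 2 * \1_U + a ^+ 2]: on [U] this is [0 <= (l - a) ^+ 2], and off [U]
    one has [a = 0]. The parameter [l] is left free, to be chosen later. *)
Lemma second_moment (I : eqType) (s : seq I) (A : I -> set T) (U : set T) (l : R) :
  (forall i, measurable (A i)) -> measurable U ->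
  (forall i, i \in s -> A i `<=` U) -> 0 <= l ->
  2 * l * \sum_(i <- s) fine (mu (A i)) <=
  l ^+ 2 * fine (mu U) + \sum_(i <- s) \sum_(j <- s) fine (mu (A i `&` A j)).
Proof.
move=> mA mU AU l0.
have ind_ge0 (B : set T) x : (0 <= (\1_B x : R)%:E)%E by rewrite lee_fin.
have mind (B : set T) : measurable B ->
    measurable_fun setT (fun x => (\1_B x : R)%:E).
  by move=> mB; apply/measurable_EFinP; exact: measurable_indic.
have intE (B : set T) : measurable B ->
    (\int[mu]_x (\1_B x)%:E = (fine (mu B))%:E)%E.
  by move=> mB; rewrite integral_indic// setIT fineK// fin_num_measure.
have l20 : 0 <= 2 * l by rewrite mulr_ge0.
have mA2 i j : measurable (A i `&` A j) by exact: measurableI.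
have lhsE : ((2 * l * \sum_(i <- s) fine (mu (A i)))%:E =
    \int[mu]_x ((2 * l)%:E * \sum_(i <- s) (\1_(A i) x)%:E))%E.
  rewrite ge0_integralZl//; last 2 first.
  - by apply: emeasurable_sum => i; exact: mind.
  - by move=> x _; exact: sume_ge0.
  rewrite ge0_integral_sum//; last by move=> i; exact: mind.
  rewrite EFinM -sumEFin. congr (_ * _)%E; apply: eq_bigr => i _. by rewrite intE.
have mrow i : measurable_fun setT (fun x => \sum_(j <- s) (\1_(A i `&` A j) x : R)%:E)%E.
  by apply: emeasurable_sum => j; exact: mind.
have row0 i x : (0 <= \sum_(j <- s) (\1_(A i `&` A j) x : R)%:E)%E by exact: sume_ge0.
have rhsE : ((l ^+ 2 * fine (mu U) + \sum_(i <- s) \sum_(j <- s) fine (mu (A i `&` A j)))%:E =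
    \int[mu]_x ((l ^+ 2)%:E * (\1_U x)%:E +
      \sum_(i <- s) \sum_(j <- s) (\1_(A i `&` A j) x)%:E))%E.
  rewrite ge0_integralD//; last 4 first.
  - by move=> x _; rewrite mule_ge0// lee_fin sqr_ge0.
  - by apply: emeasurable_funM => //; exact: mind.
  - by move=> x _; exact: sume_ge0.
  - exact: emeasurable_sum.
  rewrite ge0_integralZl//; [|exact: mind|by rewrite lee_fin sqr_ge0].
  rewrite intE// ge0_integral_sum// EFinD -EFinM; congr (_ + _)%E.
  rewrite -sumEFin; apply: eq_bigr => i _.
  rewrite ge0_integral_sum//; last by move=> j; exact: mind.
  by rewrite -sumEFin; apply: eq_bigr => j _; rewrite intE.
rewrite -lee_fin lhsE rhsE; apply: ge0_le_integral => //.
- by move=> x _; rewrite mule_ge0// sume_ge0.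
- by apply: emeasurable_funM => //; apply: emeasurable_sum => i; exact: mind.
- apply: emeasurable_funD; last exact: emeasurable_sum.
  by apply: emeasurable_funM => //; exact: mind.
move=> x _; set a := \sum_(i <- s) (\1_(A i) x : R).
have -> : (\sum_(i <- s) \sum_(j <- s) (\1_(A i `&` A j) x : R)%:E = (a ^+ 2)%:E)%E.
  rewrite expr2 mulr_suml -sumEFin; apply: eq_bigr => i _.
  rewrite mulr_sumr -sumEFin; apply: eq_bigr => j _.
  by rewrite indicI.
rewrite sumEFin -/a -!EFinM -EFinD lee_fin.
have [Ux|nUx] := pselect (U x).
  rewrite indicE mem_set//= mulr1 -subr_ge0.
  have -> : l ^+ 2 + a ^+ 2 - 2 * l * a = (l - a) ^+ 2 by ring.
  exact: sqr_ge0.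
have -> : a = 0.
  apply: big1_seq => i /andP[_ si]; rewrite indicE memNset// => Ax.
  exact/nUx/(AU i).
by rewrite mulr0 indicE memNset//= mulr0 expr0n addr0.
Qed.

Lemma limn_einf_lt_near (u : nat -> \bar R) (c : \bar R) : (limn_einf u < c)%E ->
  forall N, exists2 n, (N <= n)%N & (u n < c)%E.
Proof.
move=> uc N; apply: contrapT => /forall2NP nu.
have : (c <= limn_einf u)%E.
  rewrite limn_einf_lim; apply: lime_ge; first exact: is_cvg_einfs.
  near=> m; apply: le_ereal_inf_tmp => _ [k /= mk <-].
  case: (nu k) => [|/negP]; last by rewrite -leNgt.
  have Nm : (N <= m)%N by near: m; exact: nbhs_infty_ge.
  by move=> /negP; rewrite (leq_trans Nm mk).
by rewrite leNgt uc.
Unshelve. all: by end_near. Qed.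

(* Finite horizon form of the Kochen-Stone lemma: [second_moment] with
   [l = (2 * d0 + 3) * a], where [a] is the first moment. *)
Lemma union_prob_ge (A : nat -> set T) (d0 : R) : 0 < d0 ->
  (forall n, measurable (A n)) ->
  (\sum_(1 <= n <oo) mu (A n) = +oo)%E ->
  (limn_einf (fun N : nat =>
     ((\sum_(1 <= n < N.+1) \sum_(1 <= m < N.+1)
         fine (mu (A n `&` A (n + m)%N)))
      / (\sum_(1 <= n < N.+1) fine (mu (A n))) ^+ 2)%:E) <= d0%:E)%E ->
  exists N, (2 * d0 + 3)^-1 <= fine (mu (\big[setU/set0]_(1 <= n < N.+1) A n)).
Proof.
move=> d0_gt0 mA sumA ratio.
have fin n : fine (mu (A n)) >= 0 by exact: fine_ge0.
(* Past [N0] the first moment [a] exceeds 1, so the diagonal term [a] can be absorbed into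
   [a ^+ 2]. *)
have [N0 aN0] : exists N0, 1 < \sum_(1 <= n < N0.+1) fine (mu (A n)).
  apply: contrapT => /forallNP h.
  suff : (\sum_(1 <= n <oo) mu (A n) <= 1)%E by rewrite sumA.
  apply: lime_le; first exact: is_cvg_nneseries.
  apply: nearW => -[|N]; first by rewrite big_geq.
  rewrite leNgt; apply/negP => hN; apply: (h N); rewrite -lte_fin -sumEFin.
  by under eq_bigr do rewrite fineK ?fin_num_measure//.
(* A lower limit at most [d0] need not give terms at most [d0]; the slack 1 makes the bound strict,
   hence attained at some index beyond [N0]. *)
have d0_lt : (d0%:E < (d0 + 1)%:E)%E by rewrite lte_fin ltrDl.
have [N NN0] := limn_einf_lt_near _ _ (le_lt_trans ratio d0_lt) N0.
set a := \sum_(1 <= n < N.+1) fine (mu (A n)).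
set D := \sum_(1 <= n < N.+1) \sum_(1 <= m < N.+1) _.
have a1 : 1 < a.
  apply: (lt_le_trans aN0); rewrite /a (@big_cat_nat _ _ _ N0.+1 _ N.+1)//=.
  by rewrite lerDl sumr_ge0.
have a20 : 0 < a ^+ 2 by rewrite exprn_gt0// (lt_trans ltr01).
rewrite lte_fin ltr_pdivrMr// => Da.
exists N; set U := \big[_/_]_(_ <= _ < _) _.
have mU : measurable U by exact: bigsetU_measurable.
have AU i : i \in index_iota 1 N.+1 -> A i `<=` U.
  by move=> iN; rewrite /U -bigcup_seq; exact: bigcup_sup.
(* The double sum of intersections is at most [a + 2 * D <= a ^+ 2 + 2 * (d0 + 1) * a ^+ 2 = r * a
   ^+ 2]. Given this bound, [l = r * a] is the optimal parameter, and it yields the lower bound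
   [r^-1]. *)
set r := 2 * d0 + 3; have r0 : 0 < r by rewrite /r; lra.
have := second_moment _ _ _ _ (r * a) mA mU AU.
rewrite -/a => /(_ (mulr_ge0 (ltW r0) (ltW (lt_trans ltr01 a1)))).
have := @sum_symmetric_le R (fun n k => fine (mu (A n `&` A k))) N.
rewrite -/D; under [X in _ -> _ -> _ <= X + _]eq_bigr do rewrite setIid.
rewrite -/a => symD.
have {}symD := symD (fun n k => congr1 (fun B => fine (mu B)) (setIC _ _))
  (fun n k => fine_ge0 (measure_ge0 _ _)).
move=> mom; have {}mom := le_trans mom (lerD (lexx _) symD).
have {}mom : 2 * r * a ^+ 2 <= (r ^+ 2 * fine (mu U) + (2 * d0 + 3)) * a ^+ 2.
  apply: (@le_trans _ _ ((r * a) ^+ 2 * fine (mu U) + (a + D *+ 2))).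
    by apply: le_trans mom; rewrite expr2 !mulrA.
  have : a <= a ^+ 2 by rewrite expr2 ler_peMl//; lra.
  nra.
have {mom} := mom; rewrite ler_pM2r// -/r => mom.
rewrite -(@ler_pM2l _ (r ^+ 2)) ?exprn_gt0// expr2 mulfK ?gt_eqF//.
by rewrite -expr2; lra.
Qed.

End second_moment.

(** * From kernels to the chain: support in the subgroup and infinitely many visits *)

Section markov_random_walk.
Local Open Scope ereal_scope.
Context {d dO} {X : measurableType d} {Om : measurableType dO} {R : realType}.
Variable P : R.-pker (state X R) ~> (state X R).
Variable Z : nat -> Om -> state X R.
Hypothesis mZ : forall n, measurable_fun setT (Z n).

Let o : R * R := (0%R, 0%R).

Lemma measurable_Z_in n (B : set (state X R)) : measurable B ->
  measurable [set w | B (Z n w)].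
Proof. by move=> mB; rewrite -[X in measurable X]setTI; exact: mZ. Qed.

Lemma chain_dirac (Pr : probability Om R) x Bs : is_MRW_chain P Z \d_x Pr ->
  measurable_seq Bs ->
  Pr [set w | forall i, (i < size Bs)%N -> nth setT Bs i (Z i.+1 w)] =
  iter_kernel P Bs (x, o).
Proof.
move=> PrP mBs; have := PrP setT Bs measurableT mBs.
have -> : [set w | [set: state X R] (Z 0%N w)] = setT by [].
rewrite setTI => ->; rewrite integral_dirac//.
  by rewrite diracT mul1e indicT mul1e.
under eq_fun do rewrite indicT mul1e.
apply: (measurableT_comp (measurable_iter_kernel P Bs mBs)).
exact: measurable_fun_pair.
Qed.

(** The support condition at time 1 says that [P (x, o)] is carried by [X * S]. Translating by [t]
    in [S] maps this set onto itself, as [S] is a group, so the same holds for [P (x, t)]: the set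
    is absorbing. *)
Lemma kernel_subgroup_compl (Pr : X -> probability Om R) (S : set (R * R)) :
  (forall (x : X) (s : R * R) (A : set X) (S : set (R * R)),
     measurable A -> measurable S ->
     P (x, s) (A `*` S) = P (x, (0%R, 0%R)) (A `*` shiftS S s)) ->
  closed_subgroup2 S -> (forall x, is_MRW_chain P Z \d_x (Pr x)) ->
  (forall x, Pr x [set w | S (Z 1%N w).2] = 1) ->
  forall z, S z.2 -> P z (~` [set z | S z.2]) = 0.
Proof.
move=> Ptrans [cS S0 SB _] PrP supp [x t] /= St.
set G := [set z : state X R | S z.2].
have mG : measurable G.
  rewrite -[G]setTI; apply: measurable_snd => //; exact: measurable_closed_prod.
have PG1 : P (x, o) G = 1.
  have mGs : measurable_seq [:: G] by case.
  rewrite -(supp x); transitivity (iter_kernel P [:: G] (x, o)).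
    by rewrite /=; under eq_integral do rewrite mule1; rewrite integral_indic// setIT.
  rewrite -(chain_dirac _ _ _ (PrP x) mGs); congr (Pr x _).
  by apply/seteqP; split => w /= => [/(_ 0%N erefl)//|Gw [|]].
have PtG : P (x, t) G = 1.
  have -> : (x, t) = translate t (x, o).
    by rewrite /translate /= !add0r -surjective_pairing.
  rewrite (kernel_translate _ Ptrans)// -[RHS]PG1; congr (P _ _).
  apply/seteqP; split => -[y u]; rewrite /G /translate /=.
    by move=> /SB /(_ St) /=; rewrite !addrK -surjective_pairing.
  (* Only differences are available: [u + t] is obtained as [u - (0 - t)]. *)
  move=> Su; have := SB _ _ Su (SB _ _ S0 St).
  by rewrite /= !sub0r !opprK.
have PT : P (x, t) setT = 1 by exact: prob_kernel.
have := PT; rewrite -(setUv G) measureU//; last 2 first.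
- exact: measurableC.
- exact: setICr.
rewrite /= PtG; case: (P (x, t) (~` G)) => // y.
by rewrite -EFinD => -[] /eqP; rewrite -[X in _ == X]addr0 (inj_eq (addrI _)) => /eqP ->.
Qed.

(** * Almost surely, the chain does not remain in [D] from some time on *)

Section avoid.
Variables (mu : probability X R) (Pr : probability Om R).
Hypothesis PrP : is_MRW_chain P Z mu Pr.
Variables (D G : set (state X R)) (r : R).
Hypotheses (mD : measurable D) (mG : measurable G).
Hypotheses (r0 : (0 <= r)%R) (r1 : (r < 1)%R).
Hypothesis Go : forall x, G (x, o).
Hypothesis PG : forall z, G z -> P z (~` G) = 0.
Hypothesis limD : forall z, G z ->
  limn (fun n => iter_kernel P (nseq n D) z) <= r%:E.

(** The chain is in [D] at times [N + 1] to [N + M]. The first [N] constraints are trivial, which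
    puts the event in the list form required by [is_MRW_chain]. *)
Let stay N M := [set w | forall i, (i < N + M)%N ->
  nth setT (nseq N setT ++ nseq M D) i (Z i.+1 w)].

Let stayE N M : stay N M = \bigcap_(i in `I_M) [set w | D (Z (N + i).+1 w)].
Proof.
apply/seteqP; split => w /= Dw i.
  move=> /= iM; have := Dw (N + i)%N; rewrite ltn_add2l => /(_ iM).
  by rewrite nth_cat size_nseq ltnNge leq_addr/= addKn nth_nseq iM.
move=> iNM; rewrite nth_cat size_nseq; case: ltnP => [iN|Ni].
  by rewrite nth_nseq iN.
have iM : (i - N < M)%N by rewrite ltn_subLR.
by rewrite nth_nseq iM; have := Dw _ iM; rewrite /= subnKC.
Qed.

Lemma eventually_stay_eq0 N :
  Pr [set w | forall n, (N < n)%N -> D (Z n w)] = 0.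
Proof.
have mN : measurable_seq (nseq N [set: state X R]) by exact: measurable_seq_nseq.
have mNM M : measurable_seq (nseq N [set: state X R] ++ nseq M D).
  by apply: measurable_seq_cat => //; exact: measurable_seq_nseq.
have mcomp M : measurable_fun setT
    (fun x => iter_kernel P (nseq N [set: state X R] ++ nseq M D) (x, o)).
  apply: (measurableT_comp (measurable_iter_kernel P _ (mNM M))).
  exact: measurable_fun_pair.
have PrE M : Pr (stay N M) =
    \int[mu]_x ((\1_setT x)%:E * iter_kernel P (nseq N setT ++ nseq M D) (x, o)).
  have := PrP setT _ measurableT (mNM M).
  have -> : [set w | [set: state X R] (Z 0%N w)] = setT by [].
  by rewrite setTI size_cat !size_nseq => ->.
have -> : [set w | forall n, (N < n)%N -> D (Z n w)] = \bigcap_M stay N M.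
  apply/seteqP; split => w /= Dw.
    by move=> M _; rewrite stayE => i _; apply: Dw; rewrite ltnS leq_addr.
  move=> n Nn; have := Dw (n - N)%N I; rewrite stayE => /(_ (n - N).-1) /=.
  rewrite ltn_predL subn_gt0 => /(_ Nn).
  by rewrite -addnS prednK ?subn_gt0// subnKC// ltnW.
have mstay M : measurable (stay N M).
  by rewrite stayE; apply: fin_bigcap_measurable => // i _; exact: measurable_Z_in.
have staycvg : (Pr \o stay N) M @[M --> \oo] --> Pr (\bigcap_M stay N M).
  apply: nonincreasing_cvg_mu => //.
  - by rewrite (le_lt_trans (probability_le1 _ _))// ltry.
  - exact: bigcapT_measurable.
  - move=> m n mn; apply/subsetPset; rewrite !stayE.
    by move=> w Dw i /= im; apply: Dw => /=; exact: leq_trans mn.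
set v := Pr (\bigcap_M stay N M).
(* The Markov property at time [N + M]: [v] is the limit in [L] of the probability of
   [stay N (M + L)], and the last [L] constraints contribute at most the factor [r] in the limit. At
   time 0 every [(x, o)] lies in [G], so [setT] serves as the set of good initial points. *)
have vle M : v <= r%:E * Pr (stay N M).
  have -> : v = limn (fun L => \int[mu]_x ((\1_setT x)%:E *
      iter_kernel P ((nseq N setT ++ nseq M D) ++ nseq L D) (x, o))).
    apply/esym/cvg_lim => //.
    have := staycvg; rewrite -(cvg_shiftn M) /=; apply: cvg_trans.
    apply: near_eq_cvg; apply: nearW => L /=.
    by rewrite PrE -catA -nseqD addnC.
  rewrite PrE; apply: (lim_integral_indic_le _ _ _ _ _ setT) => //.
  - exact: probability_setT.
  - by rewrite setCT measure0.
  - by move=> n; rewrite -catA -nseqD.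
  - move=> n x; rewrite iter_kernel_ge0 iter_kernel_le1//.
    by rewrite -catA -nseqD.
  - by move=> x; exact: iter_kernel_nseq_nonincreasing.
  - by move=> x; exact: iter_kernel_ge0.
  - by move=> x _; apply: (lim_iter_kernel_cat_le _ _ _ G) => //; exact: limD.
have vfin : v \is a fin_num by rewrite fin_num_measure//; exact: bigcapT_measurable.
have : v <= r%:E * v.
  have /cvg_lim <- // : r%:E * Pr (stay N M) @[M --> \oo] --> r%:E * v.
    by apply: cvgeZl => //; exact: staycvg.
  apply: lime_ge; last exact: nearW.
  by apply/cvg_ex; exists (r%:E * v); apply: cvgeZl => //; exact: staycvg.
have v0 : 0 <= v by exact: measure_ge0.
clearbody v; case: v v0 vfin {vle staycvg} => // v; rewrite !lee_fin => v0 _ vr.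
congr EFin; apply/eqP; rewrite eq_le v0 andbT leNgt; apply/negP => vp.
by have := ltr_pM2r vp r 1%R; rewrite r1 mul1r ltNge vr.
Qed.

(** The complementary event is the countable union over [N] of the null events of
    [eventually_stay_eq0]. *)
Lemma infinitely_often_eq1 :
  Pr [set w | forall N, exists2 n, (N <= n)%N & ~ D (Z n w)] = 1.
Proof.
pose E N := [set w | forall n, (N < n)%N -> D (Z n w)].
have mE N : measurable (E N).
  have -> : E N = \bigcap_(n in [set n | (N < n)%N]) [set w | D (Z n w)] by [].
  by apply: bigcap_measurable => [|n _]; [exists N.+1 => /=|exact: measurable_Z_in].
have -> : [set w | forall N, exists2 n, (N <= n)%N & ~ D (Z n w)] = ~` \bigcup_N E N.
  apply/seteqP; split => w /=.
    by move=> io [N _ EN]; have [n Nn] := io N.+1; apply; exact: EN.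
  move=> nE N; apply: contrapT => /forall2NP nD; apply: nE; exists N => // n Nn.
  by case: (nD n) => [|/contrapT//]; rewrite (ltnW Nn).
rewrite probability_setC; last exact: bigcupT_measurable.
rewrite [X in _ - X](_ : _ = 0) ?sube0//.
apply: measure_negligible; first exact: bigcupT_measurable.
apply: negligible_bigcup => N; apply/negligibleP => //.
exact: eventually_stay_eq0.
Qed.

End avoid.

End markov_random_walk.

(** * Recurrence of every point of the subgroup *)

Lemma avoid_setC {Om X : Type} {R : realType} (Z : nat -> Om -> X * (R * R)) s (eps : R) N :
  [set w | forall i, (i < size (nseq N (@far R X s eps)))%N ->
     nth setT (nseq N (@far R X s eps)) i (Z i.+1 w)] =
  ~` \big[setU/set0]_(1 <= n < N.+1) [set w | dist2 (Z n w).2 s < eps].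
Proof.
(* Position [i] of the list constrains time [i.+1], which accounts for the range from 1 to [N] of
   the union. *)
rewrite -bigcup_seq setC_bigcup size_nseq; apply/seteqP; split => w /= h i.
  rewrite /= mem_index_iota; case: i => // i /andP[_]; rewrite ltnS => iN.
  by have := h i iN; rewrite nth_nseq iN /far /= leNgt => /negP.
move=> iN; rewrite nth_nseq iN /far /= leNgt; apply/negP.
by apply: (h i.+1); rewrite /= mem_index_iota.
Qed.
Theorem mainTheorem2 (d dO : measure_display) (R : realType)
  (X : measurableType d) (Om : measurableType dO)
  (P : R.-pker (state X R) ~> (state X R))
  (Z : nat -> Om -> state X R)
  (Pr : probability X R -> probability Om R)
  (pi : probability X R) (Ssub : set (R * R))
  (HZ : forall n, measurable_fun setT (Z n))
  (Hchain : forall mu : probability X R, is_MRW_chain P Z mu (Pr mu))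
  (Htrans : forall (x : X) (s : R * R) (A : set X) (S : set (R * R)),
     measurable A -> measurable S ->
     P (x, s) (A `*` S) = P (x, (0%R : R, 0%R : R)) (A `*` shiftS S s))
  (Hinv : forall A : set X, measurable A ->
     pi A = (\int[pi]_x P (x, (0%R : R, 0%R : R)) (A `*` setT))%E)
  (Hint1 : (Pr pi).-integrable setT (fun w => ((Z 1%N w).2.1)%:E))
  (Hint2 : (Pr pi).-integrable setT (fun w => ((Z 1%N w).2.2)%:E))
  (Hmean1 : (\int[Pr pi]_w ((Z 1%N w).2.1)%:E = 0)%E)
  (Hmean2 : (\int[Pr pi]_w ((Z 1%N w).2.2)%:E = 0)%E)
  (HS : closed_subgroup2 Ssub)
  (Hsupp : forall (x : X) (n : nat),
     Pr (\d_x) [set w | Ssub (Z n w).2] = 1%E)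
  (Hmain : exists epsS d0 : R, [/\ 0 < epsS, 0 < d0 &
     forall eps : R, 0 < eps < epsS -> forall (x : X) (s : R * R), Ssub s ->
       let A n := [set w | dist2 (Z n w).2 s < eps] in
       (\sum_(1 <= n <oo) Pr (\d_x) (A n) = +oo)%E /\
       (limn_einf (fun N : nat =>
          ((\sum_(1 <= n < N.+1) \sum_(1 <= m < N.+1)
               fine (Pr (\d_x) (A n `&` A (n + m)%N)))
           / (\sum_(1 <= n < N.+1) fine (Pr (\d_x) (A n))) ^+ 2)%:E)
        <= d0%:E)%E]) :
  forall mu : probability X R, recurrence_set Z (Pr mu) Ssub = Ssub.
Proof.
move=> mu; apply/seteqP; split => s; first by case.
move=> Ss; split=> // eps eps0.
have [epsS [d0 [epsS0 d00 main]]] := Hmain.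
have [cS S0 SB _] := HS.
(* The moment hypotheses only concern radii below [epsS]; infinitely many visits to a smaller ball
   give those to the ball of radius [eps]. *)
pose eps' := Num.min eps (epsS / 2).
have eps'_gt0 : 0 < eps' by rewrite lt_min eps0 divr_gt0.
have eps'_lt : 0 < eps' < epsS.
  rewrite eps'_gt0 (@le_lt_trans _ _ (epsS / 2)) ?ge_min ?lexx ?orbT//.
  by rewrite ltr_pdivrMr// ltr_pMr// ltr1n.
pose G := [set z : state X R | Ssub z.2].
have mG : measurable G.
  rewrite -[G]setTI; apply: measurable_snd => //; exact: measurable_closed_prod.
(* The complement of the hitting bound in [union_prob_ge]; it depends on [d0] alone, hence is
   uniform in the starting state. *)
pose r := 1 - (2 * d0 + 3)^-1.
have r0 : 0 <= r by rewrite subr_ge0 invf_le1; lra.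
have r1 : r < 1 by rewrite ltrBlDr ltrDl invr_gt0; lra.
have mfar s' : measurable (@far R X s' eps') by exact: measurable_far.
have limD z : G z -> (limn (fun n => iter_kernel P (nseq n (far s eps')) z) <= r%:E)%E.
  (* The translated target [s'] stays in the subgroup, so the hypotheses apply to it. The horizon
     [N] found below may depend on [(x, t)], but avoidance probabilities decrease with the horizon,
     so the limit is still at most [r]. *)
  case: z => x t Gt; set s' := (s.1 - t.1, s.2 - t.2).
  have [sumA ratio] := main _ eps'_lt x s' (SB _ _ Ss Gt).
  set A := fun n => [set w | dist2 (Z n w).2 s' < eps'] in sumA ratio.
  have mA n : measurable (A n).
    have -> : A n = ~` [set w | far s' eps' (Z n w)].
      by apply/seteqP; split => w; rewrite /A /far /= ltNge => /negP.
    by apply: measurableC; exact: measurable_Z_in.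
  have [N hN] := union_prob_ge _ _ _ (Pr \d_x) A d0 d00 mA sumA ratio.
  have mU : measurable (\big[setU/set0]_(1 <= n < N.+1) A n).
    exact: bigsetU_measurable.
  have avoidN : (iter_kernel P (nseq N (far s eps')) (x, t) <= r%:E)%E.
    rewrite (avoid_translate _ Htrans) -(chain_dirac P Z _ _ _ (Hchain \d_x)); last first.
      exact: measurable_seq_nseq.
    rewrite avoid_setC probability_setC//.
    rewrite -(fineK (fin_num_measure (Pr \d_x) _ mU)) -EFinB lee_fin.
    by rewrite lerD2l lerN2.
  have noninc := iter_kernel_nseq_nonincreasing P [::] (far s eps') (x, t).
  apply: lime_le.
    by apply: ereal_nonincreasing_is_cvgn; exact: noninc.
  exists N => // n /= Nn; apply: le_trans avoidN; exact: noninc.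
have PG := kernel_subgroup_compl P Z (fun x => Pr \d_x) Ssub Htrans HS
  (fun x => Hchain \d_x) (fun x => Hsupp x 1%N).
have io := infinitely_often_eq1 P Z HZ mu (Pr mu) (Hchain mu) (far s eps') G r
  (mfar s) mG r0 r1 (fun=> S0) PG limD.
have mio e : measurable [set w | forall N, exists2 n, (N <= n)%N & dist2 (Z n w).2 s < e].
  have -> : [set w | forall N, exists2 n, (N <= n)%N & dist2 (Z n w).2 s < e] =
      \bigcap_N \bigcup_(n in [set n | (N <= n)%N]) ~` [set w | far s e (Z n w)].
    apply/seteqP; split => w h N.
      by move=> _; have [n Nn hn] := h N; exists n => //=; apply/negP; rewrite -ltNge.
    by have [n /= Nn /negP] := h N I; rewrite -ltNge; exists n.
  apply: bigcapT_measurable => N; apply: bigcup_measurable => n _.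
  by apply: measurableC; apply: measurable_Z_in => //; exact: measurable_far.
apply/eqP; rewrite eq_le probability_le1//= -io.
(* The event of probability 1 for [eps'] is contained in the one for [eps], because
   [eps' <= eps]. *)
apply: le_measure; rewrite ?inE//.
  rewrite [X in measurable X](_ : _ =
    [set w | forall N, exists2 n, (N <= n)%N & dist2 (Z n w).2 s < eps'])//.
  apply/seteqP; split => w h N; have [n Nn hn] := h N; exists n => //.
    by move/negP : hn; rewrite -ltNge.
  by apply/negP; rewrite -ltNge.
move=> w h N; have [n Nn /negP] := h N; rewrite -ltNge => hn.
by exists n => //; apply: (lt_le_trans hn); rewrite ge_min lexx.
Qed.
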